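(* Let $X$ be a finite non-empty alphabet and let $G<\mathrm{Aut}(X^* )$ be a contracting self-similar group. Then $G$ has no free non-abelian subgroups.
   Context: $X^*$ is the set of finite words over $X$, including the empty word $\varnothing$, viewed as a rooted tree with root $\varnothing$ in which a word $v$ is connected by an edge to each word $vx$, $x\in X$. $\mathrm{Aut}(X^* )$ is the group of automorphisms of this rooted tree (tree automorphisms fixing the root; they preserve word length). For $g\in\mathrm{Aut}(X^* )$ and $v\in X^*$, $g|_v$ denotes the unique automorphism of $X^*$ such that $g(vu)=g(v)\,g|_v(u)$ for all $u\in X^*$. A group $G<\mathrm{Aut}(X^* )$ is self-similar if $g|_v\in G$ for all $g\in G$ and $v\in X^*$. A self-similar group $G$ is contracting if there exists a finite set $\mathcal{N}\subset G$ such that for every $g\in G$ there exists $n$ such that $g|_v\in\mathcal{N}$ for all words $v\in X^*$ of length more than $n$. (The group $G$ is not assumed finitely generated.) *)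

(* Defs.v *)
From HB Require Import structures.
From mathcomp Require Import all_boot.
From mathcomp Require Import mathcomp_extra boolp classical_sets cardinality.

Set Implicit Arguments.
Unset Strict Implicit.
Unset Printing Implicit Defensive.

Local Open Scope classical_set_scope.
Local Open Scope group_scope.

(* The tree X^* has vertex set [seq X], with root [::]. *)
Definition tree_edge (X : Type) (v w : seq X) : Prop :=
  exists x, w = rcons v x \/ v = rcons w x.

Definition is_tree_aut (X : Type) (f : seq X -> seq X) : Prop :=
  [/\ bijective f, f [::] = [::] &
      forall v w, tree_edge (f v) (f w) <-> tree_edge v w].

Section TreeAutBasics.
Variable X : Type.
Implicit Types (f : seq X -> seq X) (u v w : seq X).

Lemma tree_edge_rcons v x : tree_edge v (rcons v x).
Proof. by exists x; left. Qed.

Lemma tree_catI u : injective (cat u).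
Proof. by move=> v w /(congr1 (drop (size u))); rewrite !drop_size_cat. Qed.

Lemma tree_edge_cat u v w : tree_edge (u ++ v) (u ++ w) <-> tree_edge v w.
Proof.
split=> -[x [h|h]]; exists x.
- by left; apply: (@tree_catI u); rewrite h rcons_cat.
- by right; apply: (@tree_catI u); rewrite h rcons_cat.
- by left; rewrite h rcons_cat.
- by right; rewrite h rcons_cat.
Qed.

Lemma is_tree_aut_id : is_tree_aut (@id (seq X)).
Proof. by split=> //; exists id. Qed.

Lemma is_tree_aut_comp f g :
  is_tree_aut f -> is_tree_aut g -> is_tree_aut (f \o g).
Proof.
move=> [bf f0 fE] [bg g0 gE]; split; first exact: bij_comp.
  by rewrite /= g0.
by move=> v w; rewrite fE.
Qed.

Lemma is_tree_aut_inv f g :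
  cancel f g -> cancel g f -> is_tree_aut f -> is_tree_aut g.
Proof.
move=> fK gK [_ f0 fE]; split; first by exists f.
  by rewrite -[in LHS]f0 fK.
by move=> v w; rewrite -fE !gK.
Qed.

Lemma is_tree_aut_rcons f : is_tree_aut f ->
  forall v x, exists y, f (rcons v x) = rcons (f v) y.
Proof.
move=> [/bij_inj fI f0 fE]; elim/last_ind => [|v z IHv] x.
  have [y [|]] := (fE _ _).2 (tree_edge_rcons [::] x); first by exists y.
  by rewrite f0 => /(congr1 size); rewrite size_rcons.
have [y [|]] := (fE _ _).2 (tree_edge_rcons (rcons v z) x); first by exists y.
have [t ->] := IHv z; move=> /rcons_inj[/fI /(congr1 size)].
by rewrite !size_rcons => /eqP; rewrite -addn2 -{1}[size v]addn0 eqn_add2l.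
Qed.

Lemma is_tree_aut_size f v : is_tree_aut f -> size (f v) = size v.
Proof.
move=> fA; elim/last_ind: v => [|v x IHv]; first by case: fA => _ ->.
by have [y ->] := is_tree_aut_rcons fA v x; rewrite !size_rcons IHv.
Qed.

Lemma is_tree_aut_cat f v u : is_tree_aut f ->
  f (v ++ u) = f v ++ drop (size v) (f (v ++ u)).
Proof.
move=> fA; elim/last_ind: u => [|u x IHu].
  by rewrite cats0 drop_oversize ?cats0 // is_tree_aut_size.
rewrite -rcons_cat; have [y ->] := is_tree_aut_rcons fA (v ++ u) x.
by rewrite IHu rcons_cat -(is_tree_aut_size v fA) !drop_size_cat.
Qed.

Lemma is_tree_aut_section f v : is_tree_aut f ->
  is_tree_aut (fun u => drop (size v) (f (v ++ u))).
Proof.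
move=> fA; have [[g fK gK] f0 fE] := fA.
have gA := is_tree_aut_inv fK gK fA.
have szf := is_tree_aut_size v fA.
split.
- exists (fun u => drop (size v) (g (f v ++ u))) => u.
    by rewrite -is_tree_aut_cat // fK drop_size_cat.
  have := is_tree_aut_cat (f v) u gA; rewrite fK szf => <-.
  by rewrite gK -szf drop_size_cat.
- by rewrite cats0 -szf drop_size.
- by move=> u w; rewrite -(tree_edge_cat (f v)) -!is_tree_aut_cat // fE
     tree_edge_cat.
Qed.

End TreeAutBasics.

Record tree_aut (X : finType) := TreeAut {
  tree_fun :> seq X -> seq X;
  tree_funP : `[< is_tree_aut tree_fun >]
}.

HB.instance Definition _ (X : finType) := [isSub for @tree_fun X].
HB.instance Definition _ (X : finType) := [Choice of tree_aut X by <:].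

Section TreeAutGroup.
Variable X : finType.
Implicit Types f g h : tree_aut X.

Lemma tree_autP f : is_tree_aut f.
Proof. exact/asboolP/tree_funP. Qed.

Lemma tree_aut_eqP f g : (forall v, f v = g v) -> f = g.
Proof. by move=> fg; apply/val_inj/funext. Qed.

Definition tree_aut_one : tree_aut X := TreeAut (asboolT (@is_tree_aut_id X)).

Definition tree_aut_mul f g : tree_aut X :=
  TreeAut (asboolT (is_tree_aut_comp (tree_autP f) (tree_autP g))).

Fact tree_aut_inv_subproof f :
  exists g : tree_aut X, cancel f g /\ cancel g f.
Proof.
have [[g fK gK] _ _] := tree_autP f.
by exists (TreeAut (asboolT (is_tree_aut_inv fK gK (tree_autP f)))).
Qed.

Definition tree_aut_inv f : tree_aut X :=
  projT1 (cid (tree_aut_inv_subproof f)).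

Fact tree_aut_mulA : associative tree_aut_mul.
Proof. by move=> f g h; apply: tree_aut_eqP. Qed.

Fact tree_aut_mul1g : left_id tree_aut_one tree_aut_mul.
Proof. by move=> f; apply: tree_aut_eqP. Qed.

Fact tree_aut_mulg1 : right_id tree_aut_one tree_aut_mul.
Proof. by move=> f; apply: tree_aut_eqP. Qed.

Fact tree_aut_mulVg : left_inverse tree_aut_one tree_aut_inv tree_aut_mul.
Proof.
move=> f; apply: tree_aut_eqP => v /=; rewrite /tree_aut_inv.
by case: cid => g [].
Qed.

Fact tree_aut_mulgV : right_inverse tree_aut_one tree_aut_inv tree_aut_mul.
Proof.
move=> f; apply: tree_aut_eqP => v /=; rewrite /tree_aut_inv.
by case: cid => g [].
Qed.

HB.instance Definition _ := isGroup.Build (tree_aut X)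
  tree_aut_mulA tree_aut_mul1g tree_aut_mulg1 tree_aut_mulVg tree_aut_mulgV.

Lemma tree_autM f g v : (f * g) v = f (g v).
Proof. by []. Qed.

Lemma tree_aut1 v : (1 : tree_aut X) v = v.
Proof. by []. Qed.

(* [tree_section g v] is g|_v; see [tree_section_cat], [tree_section_uniq]. *)
Definition tree_section g (v : seq X) : tree_aut X :=
  TreeAut (asboolT (is_tree_aut_section v (tree_autP g))).

Lemma tree_section_cat g v u : g (v ++ u) = g v ++ tree_section g v u.
Proof. exact/is_tree_aut_cat/tree_autP. Qed.

Lemma tree_section_uniq g v h :
  (forall u, g (v ++ u) = g v ++ h u) -> h = tree_section g v.
Proof.
move=> gh; apply: tree_aut_eqP => u; by apply: (@tree_catI _ (g v)); rewrite -gh tree_section_cat.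
Qed.

End TreeAutGroup.

Definition self_similar (X : finType) (G : set (tree_aut X)) : Prop :=
  group_closed (mem G) /\ forall g v, G g -> G (tree_section g v).

Definition contracting (X : finType) (G : set (tree_aut X)) : Prop :=
  exists N : set (tree_aut X), [/\ finite_set N, N `<=` G &
    forall g, G g -> exists n : nat,
      forall v : seq X, (n < size v)%N -> N (tree_section g v)].

Section FreeSubgroups.
Variable gT : groupType.
Implicit Types (B H : set gT) (w : seq (gT * bool)).

(* A letter (x, b) stands for x^-1 if b is true and for x otherwise. *)
Definition word_eval w : gT :=
  \big[*%g/1]_(l <- w) (if l.2 then l.1^-1 else l.1).

Definition reduced_word B w : Prop :=
  (forall l, l \in w -> B l.1) /\
  sorted (fun l m => m != (l.1, ~~ l.2)) w.

Definition free_basis H B : Prop :=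
  B `<=` H /\
  forall h, H h -> exists! w, reduced_word B w /\ word_eval w = h.

Definition free_subgroup H : Prop :=
  group_closed (mem H) /\ exists B, free_basis H B.

Definition abelian_set H : Prop := forall x y, H x -> H y -> commute x y.

End FreeSubgroups.

(* Main.v *)
Require Import Defs.
From mathcomp Require Import all_boot.
From mathcomp Require Import fingroup perm zify.
From mathcomp Require Import boolp classical_sets cardinality.

Set Implicit Arguments.
Unset Strict Implicit.
Unset Printing Implicit Defensive.

Local Open Scope group_scope.

(** Let a and b be distinct elements of a basis of a free group H inside the
    contracting group G. Iterating the contraction on products of two elements
    of the nucleus N shows that a product of 2^k letters a, b has all its
    sections at level n = L(k+1) in N: the depth needed grows only
    logarithmically with the length of the word
    ([contracting_sections]). For a vertex v of level n, a positive word g of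
    length 2^k acts on the subtree at v through the pair of the vertex g(v) and
    the section of g at v, which takes at most |X|^n |N| values. This bound is
    exponential in k, while the number of words is 2^(2^k). For large k two
    distinct words g, g' therefore act in the same way below v, and g^-1 g' is
    a nontrivial element of H that fixes the whole subtree at v
    ([contracting_pigeonhole]).

    It remains to get a single nontrivial element of H out of these, one for
    each vertex of level n, that fixes all these subtrees; such an element is
    the identity of the tree, a contradiction. Let K be the stabiliser in H of
    level n, a normal subgroup of H that contains powers of a and b. It
    normalises the subgroup R_v of elements that fix the subtree at v. Hence the
    commutator of an element of R_v and an element of R_w that both lie in K
    belongs to both R_v and R_w. Commutators can be kept nontrivial because H
    is free: given nontrivial f and g in H, some conjugate of g by an element
    of K does not commute with f ([free_noncommuting_conjugate]). Adding the
    vertices of level n one at a time finishes the proof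
    ([free_normal_cap]). *)

(** * Commutators in subgroups given by sets *)

Section Groups.
Variable gT : groupType.
Implicit Types (B H K R : set gT) (f g h : gT).

Lemma group_closed_setP H : group_closed (mem H) <->
  [/\ H 1, forall x y, H x -> H y -> H (x * y) & forall x, H x -> H x^-1].
Proof.
split=> [HG | [H1 HM HV]]; last first.
  by split=> [|x y]; rewrite ?inE // => Hx Hy; apply: HM => //; apply: HV.
split.
- by have [] := HG; rewrite inE.
- by move=> x y Hx Hy; have := group_closedM HG (mem_set Hx) (mem_set Hy);
    rewrite inE.
- by move=> x Hx; have := group_closedV HG (mem_set Hx); rewrite inE.
Qed.

Lemma set_conjg H x y : group_closed (mem H) -> H x -> H y -> H (x ^ y).
Proof.
move=> /group_closed_setP[_ HM HV] Hx Hy.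
by rewrite conjgE; apply: (HM); [apply: HV | apply: HM].
Qed.

Lemma set_expg H x k : group_closed (mem H) -> H x -> H (x ^+ k).
Proof.
move=> /group_closed_setP[H1 HM _] Hx; elim: k => [|k IHk] //.
by rewrite expgS; apply: HM.
Qed.

Lemma set_commg H K x y : group_closed (mem K) ->
  (forall z h, K z -> H h -> K (z ^ h)) -> K x -> H y -> K [~ x, y].
Proof.
move=> KG KH Kx Hy; have /group_closed_setP[_ KM KV] := KG.
by apply: KM; [apply: KV | apply: KH].
Qed.

Lemma set_commgr H K x y : group_closed (mem K) ->
  (forall z h, K z -> H h -> K (z ^ h)) -> H x -> K y -> K [~ x, y].
Proof.
move=> KG KH Hx Ky; have /group_closed_setP[_ _ KV] := KG.
by rewrite -invgR; apply/KV/(set_commg KG KH).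
Qed.

(** * Reduced words and free bases *)

Definition inv_letter (l : gT * bool) := (l.1, ~~ l.2).

Lemma inv_letterK : involutive inv_letter.
Proof. by case=> x []. Qed.

Lemma word_eval_cat w1 w2 :
  word_eval (w1 ++ w2) = word_eval w1 * word_eval w2 :> gT.
Proof. exact: big_cat. Qed.

Lemma word_eval_nseq l k :
  word_eval (nseq k l) = (if l.2 then l.1^-1 else l.1) ^+ k :> gT.
Proof. by rewrite /word_eval big_nseq iter_mulg_1. Qed.

Lemma word_eval_nseq_inv l k :
  word_eval (nseq k (inv_letter l)) = (word_eval (nseq k l))^-1 :> gT.
Proof.
by rewrite !word_eval_nseq -expVgn /=; case: l.2; rewrite //= invgK.
Qed.

Definition no_cancel (l m : gT * bool) := m != inv_letter l.

Lemma path_nseq_cat l k s :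
  path no_cancel l (nseq k l ++ s) = path no_cancel l s.
Proof.
elim: k => //= k ->; case: l => x l.
by rewrite /no_cancel xpair_eqE /= eqxx; case: l.
Qed.

Lemma free_basis_inj H B w1 w2 : group_closed (mem H) -> free_basis H B ->
  reduced_word B w1 -> reduced_word B w2 ->
  word_eval w1 = word_eval w2 -> w1 = w2.
Proof.
move=> /group_closed_setP[H1 HM HV] [BH HB] r1 r2 E.
have Hw : H (word_eval w1).
  case: r1 => Bw1 _; rewrite /word_eval big_seq; apply: big_ind => // l.
  by move/Bw1/BH => Hl; case: l.2 => //; apply: HV.
have [w [_ wU]] := HB _ Hw.
by rewrite -(wU w1) // (wU w2) //; split; rewrite ?E.
Qed.

Definition positive_prod (a b : gT) (s : seq bool) :=
  \prod_(i <- s) (if i then a else b).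

(** A word without inverse letters is reduced, so distinct positive words have
    distinct values. *)
Lemma positive_prod_inj H B a b : group_closed (mem H) -> free_basis H B ->
  B a -> B b -> a != b -> injective (positive_prod a b).
Proof.
move=> HG HB Ba Bb ab s t st.
pose pos (r : seq bool) := [seq (if i then a else b, false) | i <- r].
have posr r : reduced_word B (pos r).
  split=> [l /mapP[i _ ->] /=|]; first by case: i.
  case: r => //= i r; elim: r i => //= j r IHr i.
  by rewrite IHr andbT xpair_eqE andbF.
have : pos s = pos t.
  by apply: (free_basis_inj HG HB) => //; rewrite /word_eval !big_map.
move/inj_map=> -> // i j [].
by case: i j => -[] // /eqP; rewrite ?[b == a]eq_sym (negPf ab).
Qed.

Lemma free_basis_two H B : free_basis H B -> ~ abelian_set H ->
  exists a b, [/\ B a, B b & a != b].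
Proof.
move=> [_ HB] nab; apply: contrapT => noab; apply: nab => x y Hx Hy.
have [v [[[Bv _] <-] _]] := HB x Hx; have [w [[[Bw _] <-] _]] := HB y Hy.
have Bcomm (l m : gT * bool) : B l.1 -> B m.1 -> commute l.1 m.1.
  move=> Bl Bm; have [-> //|lm] := eqVneq l.1 m.1.
  by case: noab; exists l.1, m.1.
rewrite [word_eval w]big_seq; apply: commute_prod => l /Bw Bl.
apply: commute_sym.
rewrite [word_eval v]big_seq; apply: commute_prod => m /Bv Bm.
have lm := Bcomm _ _ Bl Bm.
have lmV : commute (if l.2 then l.1^-1 else l.1) m.1.
  by case: l.2 => //; apply/commute_sym/commuteV/commute_sym.
by case: m.2 => //; apply: commuteV.
Qed.

Lemma exists_letter_notin (a b : gT) (s : seq (gT * bool)) :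
  a != b -> (size s < 4)%N ->
  exists l, [/\ l.1 = a \/ l.1 = b & l \notin s].
Proof.
move=> ab s4; pose t := [:: (a, false); (a, true); (b, false); (b, true)].
have tU : uniq t.
  by rewrite /t /= !inE !xpair_eqE !eqxx (negPf ab) /=.
case: (boolP (all (mem s) t)) => [/allP /(uniq_leq_size tU) /=|/allPn[l lt ls]].
  by rewrite leqNgt s4.
exists l; split=> //; move: lt; rewrite !inE.
by case/or4P=> /eqP->; [left|left|right|right].
Qed.

(** Among the four letters a, b and their inverses one can choose c and d so
    that, for h^-1 = c^k d^k, the reduced words of f and g can be placed next to
    those of h^-1 and h without any cancellation in f h^-1 g h and
    h^-1 g h f. These are then two reduced words, and c is also chosen
    different from the first letter of f, so they start with different
    letters and their values differ. The powers make h lie in a prescribed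
    subgroup K of which only some powers of a and b are known. *)
Lemma free_noncommuting_conjugate H B K a b k f g :
  group_closed (mem H) -> free_basis H B -> B a -> B b -> a != b ->
  group_closed (mem K) -> K (a ^+ k.+1) -> K (b ^+ k.+1) ->
  H f -> H g -> f != 1 -> g != 1 ->
  exists2 h, K h & [~ f, g ^ h] != 1.
Proof.
move=> HG HB Ba Bb ab KG Ka Kb Hf Hg f1 g1.
have [w1 [[[Bw1 rw1] Ew1] _]] := HB.2 f Hf.
have [w2 [[[Bw2 rw2] Ew2] _]] := HB.2 g Hg.
case: w1 => [|x1 s1] in Bw1 rw1 Ew1.
  by rewrite -Ew1 /word_eval big_nil eqxx in f1.
case: w2 => [|x2 s2] in Bw2 rw2 Ew2.
  by rewrite -Ew2 /word_eval big_nil eqxx in g1.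
(* c must not cancel against either end of f, nor d against either end of g
   or against c. *)
have [c [cab cs]] :=
  @exists_letter_notin a b [:: inv_letter (last x1 s1); x1] ab isT.
have [d [dab ds]] :=
  @exists_letter_notin a b [:: inv_letter x2; last x2 s2; inv_letter c] ab isT.
pose p := nseq k.+1 c ++ nseq k.+1 d.
pose q := nseq k.+1 (inv_letter d) ++ nseq k.+1 (inv_letter c).
have Eqp : word_eval p = (word_eval q)^-1.
  by rewrite !word_eval_cat !word_eval_nseq_inv invgM !invgK.
have /group_closed_setP[_ KM KV] := KG.
have Kl (l : gT * bool) : l.1 = a \/ l.1 = b -> K (word_eval (nseq k.+1 l)).
  move=> lab; rewrite word_eval_nseq.
  have Kl: K (l.1 ^+ k.+1) by case: lab => ->.
  by case: l.2; rewrite ?expVgn //; apply: KV.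
exists (word_eval q).
  by rewrite word_eval_cat !word_eval_nseq_inv; apply: KM; apply/KV/Kl.
apply/eqP => /eqP /commgP; rewrite /commute conjgE -Eqp -Ew1 -Ew2.
rewrite -!word_eval_cat => E.
have Bl (l : gT * bool) : l.1 = a \/ l.1 = b -> B l.1 by case=> ->.
have Bp l : l \in p -> B l.1.
  by rewrite mem_cat !mem_nseq => /orP[]/eqP->; apply: Bl.
have Bq l : l \in q -> B l.1.
  by rewrite mem_cat !mem_nseq => /orP[]/eqP->; apply: Bl.
have cs1 : (c != inv_letter (last x1 s1)) && (c != x1).
  by move: cs; rewrite !inE negb_or.
have {ds} /and3P[d1 d2 d3] :
    [&& d != inv_letter x2, d != last x2 s2 & d != inv_letter c].
  by move: ds; rewrite !inE !negb_or.
have {cs cs1} /andP[c1 c2] := cs1.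
have {}rw1 : path no_cancel x1 s1 := rw1.
have {}rw2 : path no_cancel x2 s2 := rw2.
have d1' : x2 != inv_letter d.
  by rewrite eq_sym (can2_eq inv_letterK inv_letterK).
have d2' : inv_letter d != inv_letter (last x2 s2).
  by rewrite (inj_eq (can_inj inv_letterK)).
have d3' : inv_letter c != d by rewrite eq_sym.
have pq1 : path no_cancel x1 (s1 ++ p ++ (x2 :: s2) ++ q).
  rewrite /p /q -!catA -[nseq k.+1 (inv_letter c)]cats0.
  do 6!rewrite ?path_nseq_cat 1?cat_path /=.
  by rewrite rw1 rw2 /no_cancel !inv_letterK c1 d3 d1' d2' d3'.
have pq2 : path no_cancel c (behead p ++ (x2 :: s2) ++ q ++ x1 :: s1).
  rewrite /p /q /= -!catA /=.
  do 6!rewrite ?path_nseq_cat 1?cat_path /=.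
  by rewrite rw1 rw2 /no_cancel !inv_letterK d3 d1' d2' d3' eq_sym c2.
suff /(congr1 (head x1)) /= /eqP :
    (x1 :: s1) ++ p ++ (x2 :: s2) ++ q = p ++ (x2 :: s2) ++ q ++ x1 :: s1.
  by rewrite eq_sym (negPf c2).
apply: (free_basis_inj HG HB); last by rewrite -!catA in E *.
- split=> [l|//].
  by rewrite mem_cat => /orP[/Bw1|] //; rewrite mem_cat => /orP[/Bp|] //;
     rewrite mem_cat => /orP[/Bw2|/Bq].
- split=> [l|//].
  by rewrite mem_cat => /orP[/Bp|] //; rewrite mem_cat => /orP[/Bw2|] //;
     rewrite mem_cat => /orP[/Bq|/Bw1].
Qed.

(** Inside a free group, nontrivial subgroups normalised by K cannot have
    trivial intersection: if f and g are in K, with f in one of them and g in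
    another, then the commutator of f and any K-conjugate of g is in both, and
    the conjugate can be chosen not to commute with f. Each R i meets K
    nontrivially for the same reason, applied to the normal subgroup K of H and
    to R i, whose given nontrivial element may lie outside K. *)
Lemma free_normal_cap H B K a b k (I : eqType) (R : I -> set gT) (s : seq I) :
  group_closed (mem H) -> free_basis H B -> B a -> B b -> a != b ->
  group_closed (mem K) -> (K `<=` H)%classic ->
  (forall z h, K z -> H h -> K (z ^ h)) ->
  K (a ^+ k.+1) -> K (b ^+ k.+1) ->
  (forall i, group_closed (mem (R i))) ->
  (forall i z h, R i z -> K h -> R i (z ^ h)) ->
  (forall i, exists z, [/\ H z, R i z & z != 1]) ->
  exists f, [/\ K f, f != 1 & forall i, i \in s -> R i f].
Proof.
move=> HG HB Ba Bb ab KG KH nKH Ka Kb RG nRK Rnt.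
pose nc := free_noncommuting_conjugate HG HB Ba Bb ab KG Ka Kb.
have [e Ke e1] : exists2 e, K e & e != 1.
  exists (a ^+ k.+1) => //; apply/eqP => a1.
  have rw : reduced_word B (nseq k.+1 (a, false)).
    split=> [l|]; first by rewrite mem_nseq => /andP[_ /eqP->].
    by have := path_nseq_cat (a, false) k [::]; rewrite cats0; apply: id.
  suff : nseq k.+1 (a, false) = [::] by [].
  apply: (free_basis_inj HG HB rw) => //.
  by rewrite word_eval_nseq /= a1 /word_eval big_nil.
elim: s => [|i s [f [Kf f1 Rf]]]; first by exists e.
have [z [Hz Riz z1]] := Rnt i.
have [g [Kg Rig g1]] : exists g, [/\ K g, R i g & g != 1].
  have [h Kh zh] := nc e z (KH _ Ke) Hz e1 z1.
  exists [~ e, z ^ h]; split=> //.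
    apply: (set_commg KG nKH) => //.
    by apply: (set_conjg HG) => //; apply: KH.
  by apply: (set_commgr (RG i) (nRK i)) => //; apply: nRK.
have [h Kh fgh] := nc f g (KH _ Kf) (KH _ Kg) f1 g1.
have Kgh : K (g ^ h) by apply: nKH => //; apply: KH.
exists [~ f, g ^ h]; split=> //.
  by apply: (set_commg KG nKH) => //; apply: KH.
move=> j; rewrite inE => /predU1P[->|/Rf Rjf].
  by apply: (set_commgr (RG i) (nRK i)) => //; apply: nRK.
exact: (set_commg (RG j) (nRK j)).
Qed.

End Groups.

(** * Stabilisers in the automorphism group of the tree *)

Section Tree.
Variable X : finType.
Implicit Types (f g h : tree_aut X) (u v w : seq X).

Lemma tree_autK g : cancel g g^-1.
Proof. by move=> v; rewrite -tree_autM mulVg. Qed.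

Lemma tree_aut_size g v : size (g v) = size v.
Proof. exact/is_tree_aut_size/tree_autP. Qed.

Lemma tree_sectionM g h v :
  tree_section (g * h) v = tree_section g (h v) * tree_section h v.
Proof.
by apply/esym/tree_section_uniq => u; rewrite !tree_autM !tree_section_cat.
Qed.

Lemma tree_section_catr g v u :
  tree_section g (v ++ u) = tree_section (tree_section g v) u.
Proof.
apply/esym/tree_section_uniq => w.
by rewrite -catA !tree_section_cat -catA.
Qed.

Definition level_stab n : set (tree_aut X) :=
  fun g => forall v, size v = n -> g v = v.

Definition subtree_fix v : set (tree_aut X) :=
  fun g => forall u, g (v ++ u) = v ++ u.

Lemma group_closed_level_stab n : group_closed (mem (level_stab n)).
Proof.
apply/group_closed_setP; split=> [v _|g h gn hn v vn|g gn v vn].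
- exact: tree_aut1.
- by rewrite tree_autM hn // gn.
- by rewrite -{1}(gn v vn) tree_autK.
Qed.

Lemma level_stabJ n g h : level_stab n g -> level_stab n (g ^ h).
Proof.
by move=> gn v vn; rewrite conjgE !tree_autM gn ?tree_aut_size // tree_autK.
Qed.

Lemma group_closed_subtree_fix v : group_closed (mem (subtree_fix v)).
Proof.
apply/group_closed_setP; split=> [u|g h gv hv u|g gv u].
- exact: tree_aut1.
- by rewrite tree_autM hv gv.
- by rewrite -{1}(gv u) tree_autK.
Qed.

Lemma subtree_fixJ v g h : h v = v -> subtree_fix v g -> subtree_fix v (g ^ h).
Proof.
move=> hv gv u; rewrite conjgE !tree_autM.
by rewrite [X in g X]tree_section_cat hv gv -{1}hv -tree_section_cat tree_autK.
Qed.

(** Vertices above level n are reached by extending them to level n, which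
    requires a letter. *)
Lemma subtree_fix_all n g : (0 < #|X|)%N ->
  (forall v, size v = n -> subtree_fix v g) -> g = 1.
Proof.
case/card_gt0P=> x _ gn; apply: tree_aut_eqP => u; rewrite tree_aut1.
have [un|/ltnW nu] := leqP (size u) n; last first.
  by rewrite -(cat_take_drop n u) gn // size_takel.
have := gn (u ++ nseq (n - size u) x) _ [::]; rewrite cats0 tree_section_cat.
by rewrite size_cat size_nseq subnKC // => /(_ erefl) /eqP;
   rewrite eqseq_cat ?tree_aut_size // => /andP[/eqP].
Qed.

(** An automorphism permutes the finite set of vertices of level n; the
    exponent is the order of that permutation. *)
Lemma level_stab_exp n g : exists k, level_stab n (g ^+ k.+1).
Proof.
have gt_proof (t : n.-tuple X) : size (g t) == n.
  by rewrite tree_aut_size size_tuple.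
pose gt t := Tuple (gt_proof t).
have gtI : injective gt.
  by move=> s t /(congr1 val) /(can_inj (tree_autK g)) /val_inj.
pose p := perm gtI.
have pk k (t : n.-tuple X) : val ((p ^+ k) t) = (g ^+ k) t.
  elim: k t => [|k IHk] t; first by rewrite perm1.
  by rewrite expgS permM IHk expgSr permE.
exists #[p].-1 => v vn; rewrite prednK ?order_gt0 //.
by have := pk #[p] (Tuple (introT eqP vn)); rewrite expg_order perm1 => <-.
Qed.

Lemma level_stab_exp2 n g h :
  exists k, level_stab n (g ^+ k.+1) /\ level_stab n (h ^+ k.+1).
Proof.
have [i gi] := level_stab_exp n g; have [j hj] := level_stab_exp n h.
have SG := group_closed_level_stab n.
exists (i.+1 * j.+1).-1; rewrite prednK //; split.
  by rewrite expgM; apply: set_expg SG gi.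
by rewrite mulnC expgM; apply: set_expg SG hj.
Qed.

(** * Sections of long products in a contracting group *)

(** The contraction depth depends on the element, but finitely many elements
    have a common one. *)
Lemma contracting_bound (G N : set (tree_aut X)) (s : seq (tree_aut X)) :
  (forall g, G g ->
     exists n, forall v, (n < size v)%N -> N (tree_section g v)) ->
  (forall g, g \in s -> G g) ->
  exists n, forall g v, g \in s -> (n < size v)%N -> N (tree_section g v).
Proof.
move=> GN; elim: s => [|g s IHs] sG; first by exists 0.
have [|m sm] := IHs; first by move=> h hs; apply: sG; rewrite inE hs orbT.
have [|n gn] := GN g; first by apply: sG; rewrite mem_head.
exists (maxn m n) => h v; rewrite inE gtn_max => /predU1P[->|hs] /andP[vm vn].
  exact: gn.
exact: sm.
Qed.

(** Choose L so that sections at level L of the elements of A, and of all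
    products of two elements of N, are in N. A product of 2^(k+1) elements is a
    product of two products of 2^k elements, whose sections at level L(k+1) are
    in N by induction; going down L more levels brings the product of these
    two sections back into N. *)
Lemma contracting_sections (G : set (tree_aut X)) (A : seq (tree_aut X)) :
  self_similar G -> contracting G -> (forall g, g \in A -> G g) ->
  exists L (N : seq (tree_aut X)), forall k (w : seq (tree_aut X)) v,
    {subset w <= A} -> size w = (2 ^ k)%N -> size v = (L * k.+1)%N ->
    tree_section (\prod_(g <- w) g) v \in N.
Proof.
move=> [GG Gss] [N0 [/finite_seqP[N ->] NG GN]] AG.
have [|n nP] := @contracting_bound G [set` N]%classic
  (A ++ [seq g * h | g <- N, h <- N]) GN.
  move=> g; rewrite mem_cat => /orP[/AG //|/allpairsP[[x y] [/= xN yN ->]]].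
  have /group_closed_setP[_ GM _] := GG.
  by apply: GM; apply: NG.
exists n.+1, N => k; elim: k => [|k IHk] w v wA.
  case: w wA => [|g [|//]] // gA _ vL; rewrite big_seq1.
  apply: nP; first by rewrite mem_cat gA ?mem_head.
  by rewrite vL muln1.
rewrite expnS mul2n -addnn => szw szv.
have kw : (2 ^ k <= size w)%N by rewrite szw leq_addr.
have kv : (n.+1 * k.+1 <= size v)%N by rewrite szv leq_pmul2l.
rewrite -(cat_take_drop (2 ^ k) w) big_cat /= -(cat_take_drop (n.+1 * k.+1) v).
rewrite tree_section_catr tree_sectionM; apply: nP; last first.
  by rewrite size_drop szv -mulnBr subSnn muln1.
rewrite mem_cat; apply/orP; right; apply/allpairsP.
eexists (_, _); split; last reflexivity; rewrite /=.
  apply: IHk; rewrite ?size_takel //; last by rewrite tree_aut_size size_takel.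
  by move=> x /mem_take; apply: wA.
apply: IHk; last by rewrite size_takel.
  by move=> x /mem_drop; apply: wA.
by rewrite size_drop szw addnK.
Qed.

(** The left side is exponential in k, the right side doubly exponential. *)
Lemma exp2_dominates c m L :
  exists k, (c ^ (L * k.+1) * m < 2 ^ (2 ^ k))%N.
Proof.
(* By c < 2^c and m < 2^m the left side is below 2^(A(k+1) + m), so it suffices
   that A(k+1) + m <= 2^k; for k = 2j the right side exceeds j^2. *)
pose A := (c * L)%N; pose j := (2 * A + m)%N; exists (2 * j)%N.
have c2 : (c ^ (L * (2 * j).+1) <= 2 ^ (A * (2 * j).+1))%N.
  rewrite /A -mulnA (expnM 2).
  case: (L * _)%N => // e; rewrite leq_exp2r //; exact/ltnW/ltn_expl.
have m2 : (m < 2 ^ m)%N by apply: ltn_expl.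
apply: (@leq_ltn_trans (2 ^ (A * (2 * j).+1) * m)).
  by rewrite leq_mul2r c2 orbT.
apply: (@leq_trans (2 ^ (A * (2 * j).+1 + m))).
  by rewrite expnD ltn_pmul2l ?expn_gt0.
rewrite leq_exp2l // mul2n -addnn expnD.
have j2 : (j < 2 ^ j)%N by apply: ltn_expl.
apply: leq_trans (leq_mul j2 j2).
by rewrite /j; lia.
Qed.

(** The action of g on the subtree at v is determined by g v and the section of
    g at v. The map sending a word of length 2^k to this pair has fewer values
    than there are words, so two words s and t have the same pair. *)
Lemma contracting_pigeonhole (G : set (tree_aut X)) a b :
  self_similar G -> contracting G -> G a -> G b ->
  exists n, forall v, size v = n -> exists s t : seq bool,
    s != t /\ subtree_fix v ((positive_prod a b s)^-1 * positive_prod a b t).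
Proof.
move=> Gss Gcontr Ga Gb.
have [|L [N NP]] := @contracting_sections G [:: a; b] Gss Gcontr.
  by move=> g; rewrite !inE => /orP[]/eqP->.
have [k kP] := exp2_dominates #|X| (size (undup N)) L.
pose r := (2 ^ k)%N; pose n := (L * k.+1)%N; exists n => v vn.
pose ev := positive_prod a b.
have img_proof (s : r.-tuple bool) : size (ev s v) == n.
  by rewrite tree_aut_size vn.
have sec_proof (s : r.-tuple bool) : tree_section (ev s) v \in undup N.
  rewrite mem_undup /ev /positive_prod.
  rewrite -(big_map (fun i => if i then a else b) xpredT id).
  apply: (NP k) => //; last by rewrite size_map size_tuple.
  by move=> g /mapP[i _ ->]; rewrite !inE; case: i; rewrite eqxx ?orbT.
pose phi (s : r.-tuple bool) : n.-tuple X * seq_sub (undup N) :=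
  (Tuple (img_proof s), SeqSub (sec_proof s)).
have /injectivePn[s [t st phist]] : ~~ injectiveb phi.
  apply/negP => /injectiveP /leq_card.
  rewrite card_prod !card_tuple card_bool leqNgt => /negP; apply.
  apply: leq_ltn_trans kP; rewrite leq_mul2l; apply/orP; right.
  by rewrite card_seq_sub ?undup_uniq.
exists s, t; split=> //.
have E1 : ev s v = ev t v := congr1 (fun z => val z.1) phist.
have E2 : tree_section (ev s) v = tree_section (ev t) v :=
  congr1 (fun z => val z.2) phist.
move=> u; rewrite tree_autM tree_section_cat -E1 -E2 -tree_section_cat.
exact: tree_autK.
Qed.

End Tree.

Theorem theorem4p2 (X : finType) (X_gt0 : (0 < #|X|)%N) (G : set (tree_aut X))
    (Gss : self_similar G) (Gcontr : contracting G) :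
  ~ exists H : set (tree_aut X),
      [/\ (H `<=` G)%classic, free_subgroup H & ~ abelian_set H].
Proof.
move=> [H [HG [Hgr [B HB]] Hnab]].
have [a [b [Ba Bb ab]]] := free_basis_two HB Hnab.
have [Ha Hb] : H a /\ H b by split; apply: HB.1.
have [n nP] := contracting_pigeonhole Gss Gcontr (HG _ Ha) (HG _ Hb).
have [k [ak bk]] := level_stab_exp2 n a b.
pose K : set (tree_aut X) := (H `&` level_stab n)%classic.
pose R (v : n.-tuple X) := subtree_fix v.
have /group_closed_setP[H1 HM HV] := Hgr.
have KG : group_closed (mem K).
  have /group_closed_setP[S1 SM SV] := @group_closed_level_stab X n.
  apply/group_closed_setP; split=> [|x y [Hx Sx] [Hy Sy]|x [Hx Sx]]; split=> //.
  - exact: HM.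
  - exact: SM.
  - exact: HV.
  - exact: SV.
have [|||||||f [_ f1 fR]] := @free_normal_cap _ H B K a b k _ R
  (enum {: n.-tuple X}) Hgr HB Ba Bb ab KG.
- by move=> x [].
- by move=> z h [Hz Sz] Hh; split; [apply: set_conjg | apply: level_stabJ].
- by split=> //; apply: set_expg.
- by split=> //; apply: set_expg.
- by move=> v; apply: group_closed_subtree_fix.
- move=> v z h Rz [_ Sh]; apply: subtree_fixJ => //.
  by apply: Sh; rewrite size_tuple.
- move=> v; have [s [t [s_t fv]]] := nP v (size_tuple v).
  have Hpos r : H (positive_prod a b r) by apply: big_ind => // -[].
  exists ((positive_prod a b s)^-1 * positive_prod a b t).
  split=> //; first by apply: HM => //; apply: HV.
  apply: contraNneq s_t => st1; apply/eqP.
  apply: (positive_prod_inj Hgr HB Ba Bb ab).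
  by apply: (mulgI (positive_prod a b s)^-1); rewrite mulVg st1.
case/eqP: f1; apply: (subtree_fix_all (n := n) X_gt0) => v vn.
by apply: (fR (Tuple (introT eqP vn))); rewrite mem_enum.
Qed.
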